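(* Let $\Delta$ be a quasi-tree on $[n]$ of dimension $d-1$, and let $\ell$ be a nonnegative integer with $\ell\leq d-1$. Let $I\subset S=K[x_1,\ldots,x_n]$ ($K$ a field) be the ideal generated by all monomials $x_F=\prod_{i\in F}x_i$ where $F$ ranges over the $(\ell+1)$-element subsets of $[n]$ with $F\notin\Delta$ (i.e. $I$ is the facet ideal of $\overline{\mathrm{skel}_\Delta(\ell)}$). Then for every $k\geq 1$ the power $I^k$ has a linear resolution.
   Context: A simplicial complex on $[n]$ is a collection of subsets of $[n]$ containing all singletons and closed under taking subsets; facets are maximal faces, and $\langle F_1,\ldots,F_m\rangle$ denotes the complex with facets $F_1,\ldots,F_m$. A facet $F$ is a leaf if either it is the only facet, or there is a facet $G\neq F$ with $H\cap F\subseteq G\cap F$ for every facet $H\neq F$. $\Delta$ is a quasi-tree if its facets can be labeled $F_1,\ldots,F_m$ so that each $F_i$ is a leaf of $\langle F_1,\ldots,F_i\rangle$. The $\ell$-skeleton $\mathrm{skel}_\Delta(\ell)$ is the complex whose facets are the $\ell$-dimensional faces of $\Delta$; for a pure $(e-1)$-dimensional complex $\Gamma$, $\bar\Gamma$ is the complex generated by all $e$-subsets of $[n]$ not in $\Gamma$; the facet ideal of a complex is generated by $x_F$ for its facets $F$. A graded ideal generated in degree $q$ has a linear resolution if in its minimal graded free resolution the $i$-th free module is generated in degree $q+i$ for all $i$. *)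

(* Defs.v *)
From HB Require Import structures.
From mathcomp Require Import all_boot all_order all_algebra.
From mathcomp Require Import mpoly.
Set Implicit Arguments. Unset Strict Implicit. Unset Printing Implicit Defensive.
Import Order.TTheory GRing.Theory Num.Theory.
Local Open Scope ring_scope.

Definition is_simplicial_complex (n : nat) (Delta : {set {set 'I_n}}) : Prop :=
  (forall i : 'I_n, [set i] \in Delta) /\
  (forall F G : {set 'I_n}, F \in Delta -> G \subset F -> G \in Delta).

Definition is_facet (n : nat) (Delta : {set {set 'I_n}}) (F : {set 'I_n}) : Prop :=
  F \in Delta /\ (forall G, G \in Delta -> F \subset G -> G = F).

(* dimension d-1 : the largest face has d elements *)
Definition has_dim_pred (n : nat) (Delta : {set {set 'I_n}}) (d : nat) : Prop :=
  (exists2 F, F \in Delta & #|F| = d) /\ (forall F, F \in Delta -> #|F| <= d)%N.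

(* F is a leaf of the complex whose set of facets is Fs *)
Definition is_leaf (n : nat) (Fs : seq {set 'I_n}) (F : {set 'I_n}) : Prop :=
  F \in Fs /\
  ((forall H, H \in Fs -> H = F) \/
   (exists G, [/\ G \in Fs, G != F &
      forall H, H \in Fs -> H != F -> (H :&: F) \subset (G :&: F)])).

Definition is_quasi_tree (n : nat) (Delta : {set {set 'I_n}}) : Prop :=
  exists s : seq {set 'I_n},
    [/\ uniq s,
        (forall F, F \in s <-> is_facet Delta F) &
        (forall i, (i < size s)%N -> is_leaf (take i.+1 s) (nth set0 s i))].

Definition xF (n : nat) (K : fieldType) (F : {set 'I_n}) : {mpoly K[n]} :=
  \prod_(i in F) 'X_i.

Definition nonface_gens (n : nat) (K : fieldType) (Delta : {set {set 'I_n}}) (l : nat)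
  : seq {mpoly K[n]} :=
  [seq xF K F | F <- enum [set F : {set 'I_n} | (#|F| == l.+1)%N && (F \notin Delta)]].

Fixpoint pow_gens (n : nat) (K : fieldType) (gs : seq {mpoly K[n]}) (k : nat)
  : seq {mpoly K[n]} :=
  match k with
  | 0 => [:: 1]
  | k'.+1 => [seq a * b | a <- gs, b <- pow_gens gs k']
  end.

Definition in_ideal (n : nat) (K : fieldType) (gs : seq {mpoly K[n]}) (p : {mpoly K[n]})
  : Prop :=
  exists c : 'I_(size gs) -> {mpoly K[n]}, p = \sum_(j < size gs) c j * gs`_j.

(* I (given as a predicate on S = K[x_1..x_n]) has a linear resolution, being
   generated in degree q: there is a graded free resolution
     ... -> F_2 -> F_1 -> F_0 -> I -> 0,   F_i = S(-q-i)^(b i),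
   i.e. the i-th free module is generated in degree q+i for all i.
   Elements of F_i are row vectors of length b i; the differential
   F_{i+1} -> F_i is v |-> v *m dd i, with dd i a (b (i+1)) x (b i) matrix;
   the augmentation F_0 -> S is v |-> v *m g, with g a column of length b 0.
   Gradedness (degree-0 maps) amounts to: entries of g homogeneous of degree q,
   entries of each dd i homogeneous of degree 1 (the zero polynomial being
   homogeneous of every degree). *)
Definition has_linear_resolution (n : nat) (K : fieldType) (q : nat)
  (I : {mpoly K[n]} -> Prop) : Prop :=
  exists (b : nat -> nat) (g : 'cV[{mpoly K[n]}]_(b 0%N))
         (dd : forall i : nat, 'M[{mpoly K[n]}]_(b i.+1, b i)),
    [/\ (forall j, g j 0 \is q.-homog),
        (forall i j k, dd i j k \is 1%N.-homog),
        (forall p, I p <-> exists v : 'rV_(b 0%N), p = (v *m g) 0 0),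
        (forall v : 'rV_(b 0%N),
            v *m g = 0 <-> exists w : 'rV_(b 1%N), v = w *m dd 0%N) &
        (forall (i : nat) (v : 'rV_(b i.+1)),
            v *m dd i = 0 <-> exists w : 'rV_(b i.+2), v = w *m dd i.+1)].

(* Main.v *)
(** A quasi-tree is the clique complex of a chordal graph, and listing its facets
    in leaf order yields a perfect elimination order of the vertices.  Hence the
    nonedges of the 1-skeleton, ordered by elimination rank, have linear quotients
    as a quadratic monomial ideal [J].  A monomial of degree [k(l+1)] is a generator
    of [I^k] iff its exponents are at most [k] and it is divisible by a product of
    [k] nonedges: the remaining variables can be distributed over the [k] nonedges,
    and the resulting sets can then be balanced to size [l+1].  Comparing such
    monomials first by the least product of [k] nonedges dividing them (largest
    nonedge first) and then lexicographically gives linear quotients for [I^k], by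
    an alternating-path exchange between two products of nonedges.

    Linear quotients with respect to variables pass to syzygies: if
    [(v_t : t < j) : v_j] is generated by the variables in [A_j], the syzygies with
    leading terms [x_i e_j], [i] in [A_j], generate the syzygy module and have
    linear quotients again.  Iterating this produces the linear resolution. *)

Require Import Defs.
From Stdlib Require Import ClassicalEpsilon.
From HB Require Import structures.
From mathcomp Require Import all_boot all_order all_algebra.
From mathcomp Require Import mpoly zify.
Set Implicit Arguments. Unset Strict Implicit. Unset Printing Implicit Defensive.
Import Order.TTheory GRing.Theory Num.Theory.
Local Open Scope ring_scope.

(** * Resolutions from linear quotients *)

Section LinearQuotients.
Variables (n : nat) (K : fieldType).
Local Notation R := {mpoly K[n]}.
Implicit Types (A : {set 'I_n}) (f g h : R).

Definition varideal A f : bool :=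
  all (fun m : 'X_{1..n} => [exists i in A, m i != 0%N]) (msupp f).

Lemma varidealP A f :
  reflect (forall m, m \in msupp f -> exists2 i, i \in A & m i != 0%N)
          (varideal A f).
Proof.
apply: (iffP allP) => H m mf; first by have /exists_inP[i] := H m mf; exists i.
by apply/exists_inP; have [i] := H m mf; exists i.
Qed.

Lemma varideal0 A : varideal A 0.
Proof. by apply/varidealP => m; rewrite msupp0. Qed.

Lemma varidealD A f g : varideal A f -> varideal A g -> varideal A (f + g).
Proof.
move=> /varidealP Hf /varidealP Hg; apply/varidealP => m /msuppD_le.
by rewrite mem_cat => /orP[/Hf|/Hg].
Qed.

Lemma varideal_sum A (I : Type) (r : seq I) (P : pred I) (F : I -> R) :
  (forall i, P i -> varideal A (F i)) -> varideal A (\sum_(i <- r | P i) F i).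
Proof.
by move=> H; apply: (big_ind (varideal A)) => //;
  [exact: varideal0 | exact: varidealD].
Qed.

Lemma varidealM A f g : varideal A g -> varideal A (f * g).
Proof.
move=> /varidealP Hg; apply/varidealP => m /msuppM_le /allpairsP[[m1 m2] /=].
case=> _ /Hg[i iA mi] ->; exists i => //; rewrite mnmDE; lia.
Qed.

Lemma varidealX A i : i \in A -> varideal A 'X_i.
Proof.
move=> iA; apply/varidealP => m; rewrite msuppX inE => /eqP ->.
by exists i; rewrite // mnm1E eqxx.
Qed.

Lemma varideal_decomp A f :
  varideal A f -> exists c : 'I_n -> R, f = \sum_(i in A) c i * 'X_i.
Proof.
move=> /varidealP Hf; rewrite [f]mpolyE big_seq.
apply: (big_ind (fun f => exists c : 'I_n -> R, f = \sum_(i in A) c i * 'X_i)).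
- by exists (fun=> 0); rewrite big1 // => i _; rewrite mul0r.
- move=> _ _ [c ->] [c' ->]; exists (fun i => c i + c' i).
  by rewrite -big_split /=; apply: eq_bigr => i _; rewrite mulrDl.
move=> m /Hf[i iA mi].
exists (fun j => if j == i then f@_m *: 'X_[m - U_(i)] else 0).
rewrite (bigD1 i) //= eqxx big1 => [|j /andP[_ /negPf ->]]; last by rewrite mul0r.
rewrite addr0 -scalerAl -mpolyXD submK //.
by apply/mnm_lepP => j; rewrite mnm1E; case: eqP => // <-; lia.
Qed.

(** The ideal of variables is prime, and multiplying by ['X_i] changes only exponents at [i]. *)
Lemma varideal_colon A i f : i \notin A -> varideal A (f * 'X_i) -> varideal A f.
Proof.
move=> iA /varidealP Hf; apply/varidealP => m; rewrite mcoeff_msupp -(mcoeffMX _ U_(i)).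
rewrite -mcoeff_msupp => /Hf[j jA]; rewrite mnmDE mnm1E.
case: (i =P j) => [ij|_]; last by move=> mj; exists j.
by rewrite ij jA in iA.
Qed.

(** Lets the coefficients of a homogeneous relation be cut down to their parts of one degree. *)
Lemma pihomog_mulr d e f h : h \is e.-homog ->
  pihomog mdeg (d + e)%N (f * h) = pihomog mdeg d f * h.
Proof.
move=> hh; rewrite {1}(pihomog_partitionE (leqnn (mmeasure mdeg f))) mulr_suml linear_sum /=.
have E d' : pihomog mdeg (d + e)%N (pihomog mdeg d' f * h) =
            if d' == d then pihomog mdeg d f * h else 0.
  have hd : pihomog mdeg d' f * h \is (d' + e).-homog.
    by apply: dhomogM => //; exact: pihomogP.
  case: eqP => [<-|ne]; first by rewrite pihomog_dE.
  by rewrite (@pihomog_ne0 _ _ _ (d' + e)) // eqn_add2r; apply/eqP.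
under eq_bigr do rewrite E.
case: (ltnP d (mmeasure mdeg f)) => [dk|kd].
  rewrite (bigD1 (Ordinal dk)) //= eqxx big1 ?addr0 // => i.
  by rewrite -val_eqE /= => /negPf ->.
rewrite big1 => [|i _]; last by case: eqP => // E'; have := ltn_ord i; lia.
rewrite pihomogE big_seq_cond big1 ?mul0r // => m /andP[mf /eqP dm].
by have := mmeasure_mnm_lt mdeg mf; rewrite dm; lia.
Qed.

(** * Linear quotients and their syzygies *)

Definition below_span m p (D : 'M[R]_(m, p)) (rho : 'I_m -> nat) (r : nat)
    (v : 'rV[R]_p) : Prop :=
  exists w : 'rV_m, (forall t, (r <= rho t)%N -> w 0 t = 0) /\ v = w *m D.

(* [A j] is the set of variables generating the ideal (rows of smaller rank) : (row [j]). *)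
Definition linear_quotients m p (D : 'M[R]_(m, p)) : Prop :=
  exists (rho : 'I_m -> nat) (A : 'I_m -> {set 'I_n}),
    injective rho /\
    forall j f, below_span D rho (rho j) (f *: row j D) <-> varideal (A j) f.

Section BelowSpan.
Variables (m p : nat) (D : 'M[R]_(m, p)) (rho : 'I_m -> nat).

Lemma below_span0 r : below_span D rho r 0.
Proof. by exists 0; split => [t _|]; rewrite ?mxE ?mul0mx. Qed.

Lemma below_spanD r u v :
  below_span D rho r u -> below_span D rho r v -> below_span D rho r (u + v).
Proof.
move=> [w [Hw ->]] [w' [Hw' ->]]; exists (w + w'); rewrite mulmxDl; split=> // t rt.
by rewrite mxE Hw // Hw' // addr0.
Qed.

Lemma below_spanZ r f v : below_span D rho r v -> below_span D rho r (f *: v).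
Proof.
move=> [w [Hw ->]]; exists (f *: w); rewrite scalemxAl; split=> // t rt.
by rewrite mxE Hw // mulr0.
Qed.

Lemma below_span_sum r (I : Type) (s : seq I) (P : pred I) (F : I -> 'rV[R]_p) :
  (forall i, P i -> below_span D rho r (F i)) ->
  below_span D rho r (\sum_(i <- s | P i) F i).
Proof.
by move=> H; apply: (big_ind (below_span D rho r)) => //;
  [exact: below_span0 | exact: below_spanD].
Qed.

Lemma below_span_row r t : (rho t < r)%N -> below_span D rho r (row t D).
Proof.
move=> tr; exists (delta_mx 0 t); rewrite -rowE; split=> // s rs.
by rewrite mxE eqxx /=; case: eqP => // E; rewrite E in rs; lia.
Qed.

Lemma below_span_le r r' v :
  (r <= r')%N -> below_span D rho r v -> below_span D rho r' v.
Proof. by move=> rr' [w [Hw ->]]; exists w; split=> // t rt; apply: Hw; lia. Qed.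

End BelowSpan.

(** Each [i] in [A j] gives a syzygy led by ['X_i] at entry [j]. Cancelling the entry of highest
    rank shows that these generate; ordered by leading row and then by variable, they have linear
    quotients again. *)
Lemma linear_quotients_syzygy e m p (D : 'M[R]_(m, p)) :
  (forall i j, D i j \is e.-homog) -> linear_quotients D ->
  exists m' (D' : 'M[R]_(m', m)),
    [/\ forall i j, D' i j \is 1%N.-homog,
        forall v : 'rV_m, v *m D = 0 <-> exists w : 'rV_m', v = w *m D' &
        linear_quotients D'].
Proof.
move=> homD [rho [A [inj_rho HA]]].
pose P := [set x : 'I_m * 'I_n | x.2 \in A x.1].
have [w Hw] : exists w : 'I_#|P| -> 'rV[R]_m, forall s,
    let x := enum_val s in
    [/\ forall t, (rho x.1 <= rho t)%N -> w s 0 t = 0,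
        forall t, w s 0 t \is 1%N.-homog & 'X_x.2 *: row x.1 D = w s *m D].
  suff: forall s : 'I_#|P|, exists w : 'rV[R]_m, let x := enum_val s in
    [/\ forall t, (rho x.1 <= rho t)%N -> w 0 t = 0,
        forall t, w 0 t \is 1%N.-homog & 'X_x.2 *: row x.1 D = w *m D].
    by move=> H; have [w Hw] := fin_all_exists H; exists w.
  move=> s; set x := enum_val s.
  have /(HA x.1)[w [Hw Ew]] : varideal (A x.1) 'X_x.2.
    by apply: varidealX; have := enum_valP s; rewrite inE.
  (* The relation expressing ['X_x.2 *: row x.1 D] is homogeneous, so the linear parts of its
     coefficients satisfy it too. *)
  exists (map_mx (pihomog mdeg 1) w); split=> [t rt|t|].
  - by rewrite mxE Hw // pihomog0.
  - by rewrite mxE; exact: pihomogP.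
  apply/rowP => c; have /rowP/(_ c) := Ew; rewrite !mxE.
  move/(congr1 (pihomog mdeg (1 + e)%N)); rewrite pihomog_dE; last first.
    by apply: dhomogM; rewrite ?dhomogX /= ?mdeg1.
  by move=> ->; rewrite linear_sum /=; apply: eq_bigr => i _; rewrite mxE (pihomog_mulr 1).
pose z s : 'rV[R]_m := 'X_(enum_val s).2 *: delta_mx 0 (enum_val s).1 - w s.
pose D' : 'M[R]_(#|P|, m) := \matrix_s z s.
have rowD' s : row s D' = z s by rewrite rowK.
have zD s : z s *m D = 0.
  rewrite mulmxBl -scalemxAl -rowE; have [_ _ ->] := Hw s; exact: subrr.
have z_hi s t : (rho (enum_val s).1 < rho t)%N -> z s 0 t = 0.
  move=> lt; have [Hw0 _ _] := Hw s; rewrite !mxE Hw0 ?subr0; last lia.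
  by rewrite eqxx /=; case: eqP lt => [->|_]; rewrite ?ltnn // mulr0.
have z_top s t : (enum_val s).1 = t -> z s 0 t = 'X_(enum_val s).2.
  move=> <-; have [Hw0 _ _] := Hw s.
  by rewrite !mxE Hw0 // subr0 !eqxx mulr1.
have D'D : D' *m D = 0 by apply/row_matrixP => s; rewrite row_mul rowD' zD row0.
have idx j i : i \in A j -> exists s : 'I_#|P|, enum_val s = (j, i).
  move=> iA; have jiP : (j, i) \in P by rewrite inE.
  by exists (enum_rank_in jiP (j, i)); rewrite enum_rankK_in.
pose rho' (s : 'I_#|P|) := (rho (enum_val s).1 * n + (enum_val s).2)%N.
have rho'_lt s r : (rho (enum_val s).1 < r)%N -> (rho' s < r * n)%N.
  by rewrite /rho'; have := ltn_ord (enum_val s).2; nia.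
have inj_rho' : injective rho'.
  move=> s s' E; apply: enum_val_inj.
  have := ltn_ord (enum_val s).2; have := ltn_ord (enum_val s').2.
  move: E; rewrite /rho'; case: (enum_val s) (enum_val s') => [a b] [a' b'] /= E lb lb'.
  have Ea : rho a = rho a' by nia.
  by rewrite (inj_rho _ _ Ea); congr pair; apply: ord_inj; move: E; rewrite Ea; lia.
(* Syzygies supported in ranks below [r] are generated by the [z s] whose leading row has rank below
   [r]. *)
have span r (v : 'rV_m) : (forall t, (r <= rho t)%N -> v 0 t = 0) -> v *m D = 0 ->
    below_span D' rho' (r * n) v.
  elim: r v => [|r IH] v v0 vD.
    suff ->: v = 0 by exact: below_span0.
    by apply/rowP => t; rewrite v0 // mxE.
  case: (pickP (fun j => rho j == r)) => [j /eqP rj|nj]; last first.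
    apply: below_span_le (IH v _ vD); first by rewrite leq_mul2r leqnSn orbT.
    by move=> t; rewrite leq_eqVlt eq_sym nj /=; exact: v0.
  (* As [v *m D = 0], the entry [v 0 j] sends [row j D] into the span of lower rows, so it lies in
     the ideal of [A j] and can be cleared by the [z s] led by [j]. *)
  have [c Ec] : exists c : 'I_n -> R, v 0 j = \sum_(i in A j) c i * 'X_i.
    apply: varideal_decomp; apply/HA; exists (v 0 j *: delta_mx 0 j - v); split.
      move=> t; rewrite leq_eqVlt => /orP[/eqP/inj_rho <-|lt].
        by rewrite !mxE !eqxx mulr1 subrr.
      have vt : v 0 t = 0 by apply: v0; rewrite -rj.
      rewrite !mxE vt subr0 eqxx /=.
      by case: eqP lt => [->|]; rewrite ?ltnn ?mulr0.
    by rewrite mulmxBl vD subr0 -scalemxAl -rowE.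
  have ex_zz : forall i, exists z' : 'rV[R]_m, i \in A j ->
     exists2 s : 'I_#|P|, enum_val s = (j, i) & z' = z s.
    move=> i; case iA: (i \in A j); last by exists 0.
    by have [s Es] := idx _ _ iA; exists (z s) => _; exists s.
  have [zz Hzz] := fin_all_exists ex_zz.
  rewrite -[v](subrK (\sum_(i in A j) c i *: zz i)); apply: below_spanD.
    apply: below_span_le (IH _ _ _).
    - by rewrite leq_mul2r leqnSn orbT.
    - move=> t; rewrite leq_eqVlt => /orP[|lt].
        rewrite eq_sym -rj => /eqP/inj_rho ->; rewrite !mxE summxE Ec.
        rewrite -sumrB big1 // => i /Hzz[s Es ->].
        by rewrite mxE z_top Es // subrr.
      rewrite !mxE v0 // summxE big1 ?subr0 // => i /Hzz[s Es ->].
      by rewrite mxE z_hi ?mulr0 // Es /= rj.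
    - rewrite mulmxBl vD mulmx_suml big1 ?subr0 // => i /Hzz[s _ ->].
      by rewrite -scalemxAl zD scaler0.
  apply: below_span_sum => i /Hzz[s Es ->]; apply: below_spanZ; rewrite -rowD'.
  by apply: below_span_row; apply: rho'_lt; rewrite Es /= rj.
exists #|P|, D'; split.
- move=> s t; rewrite mxE !mxE; have [_ Hw1 _] := Hw s.
  apply: rpredB => //; case: (_ && _); last by rewrite mulr0 rpred0.
  by rewrite mulr1 dhomogX /= mdeg1.
- move=> v; split=> [vD|[u ->]]; last by rewrite -mulmxA D'D mulmx0.
  have [t vt|u [_ ->]] := span (\max_t (rho t).+1)%N v _ vD; last by exists u.
  by have /leq_trans/(_ vt) := @leq_bigmax _ (fun t => (rho t).+1) t; rewrite ltnn.
pose A' (s : 'I_#|P|) := [set i in A (enum_val s).1 | (i < (enum_val s).2)%N].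
exists rho', A'; split=> // s f; rewrite rowD'; split.
  (* At the leading row of [s], earlier syzygies contribute zero or multiples of smaller variables
     from the same row. The leading variable of [s] is not in [A' s], so it cancels. *)
  move=> [u [Hu /rowP/(_ (enum_val s).1)]]; rewrite mxE z_top // => Ef.
  apply: (@varideal_colon _ (enum_val s).2); first by rewrite inE ltnn andbF.
  rewrite Ef mxE; apply: varideal_sum => s' _; rewrite mxE.
  case: (leqP (rho' s) (rho' s')) => [/Hu ->|lt]; first by rewrite mul0r varideal0.
  apply: varidealM; move: lt; rewrite /rho' => lt.
  have s2 := ltn_ord (enum_val s).2; have s2' := ltn_ord (enum_val s').2.
  case: (ltngtP (rho (enum_val s').1) (rho (enum_val s).1)) => [lt'|gt|/inj_rho E].
  - by rewrite z_hi // varideal0.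
  - by nia.
  rewrite z_top // varidealX // !inE -E; have := enum_valP s'; rewrite inE => -> /=.
  by move: lt; rewrite E ltn_add2l.
case/varideal_decomp => c ->; rewrite scaler_suml.
apply: below_span_sum => i; rewrite inE => /andP[iA lt].
rewrite -scalerA; apply: below_spanZ; have [s' Es'] := idx _ _ iA.
(* The leading entries of this difference cancel, so by [span] only lower leading rows occur. *)
rewrite -['X_i *: z s](subrK ('X_(enum_val s).2 *: z s')); apply: below_spanD.
  apply: below_span_le (span (rho (enum_val s).1) _ _ _).
  - by rewrite /rho' leq_addr.
  - move=> t le_t.
    have -> : ('X_i *: z s - 'X_(enum_val s).2 *: z s') 0 t =
              'X_i * z s 0 t - 'X_(enum_val s).2 * z s' 0 t by rewrite !mxE.
    move: le_t; rewrite leq_eqVlt => /orP[/eqP/inj_rho <-|lt'].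
      by rewrite !z_top ?Es' // mulrC subrr.
    by rewrite !z_hi ?Es' // !mulr0 subrr.
  - by rewrite mulmxBl -!scalemxAl !zD !scaler0 subrr.
apply: below_spanZ; rewrite -rowD'; apply: below_span_row.
by rewrite /rho' Es' /= ltn_add2l.
Qed.

(** If [m] times the [j]-th monomial is a multiple of the [t]-th, the exponents at [i] force ['X_i]
    to divide [m]; and ['X_i] already sends the [j]-th monomial into the span of earlier ones. *)
Lemma monomial_linear_quotients (s : seq 'X_{1..n}) :
  (forall t j, (t < j < size s)%N -> exists i q t',
     [/\ (t' < j)%N, (nth 0%MM s j i < nth 0%MM s t i)%N &
         (nth 0%MM s t' + U_(q) = nth 0%MM s j + U_(i))%MM]) ->
  linear_quotients (\col_(j < size s) ('X_[nth 0%MM s j] : R)).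
Proof.
move=> Hs; set D := \col__ _.
pose u (j : 'I_(size s)) := nth 0%MM s j.
pose A (j : 'I_(size s)) := [set i | [exists t : 'I_(size s), (t < j)%N &&
  [exists q : 'I_n, (u t + U_(q) == u j + U_(i))%MM]]].
exists (@nat_of_ord _), A; split; first exact: ord_inj.
move=> j f; split.
  move=> [w [Hw /matrixP/(_ 0 0)]]; rewrite !mxE => Ef.
  apply/varidealP => m; rewrite mcoeff_msupp -(mcoeffMX _ (u j)) Ef -mcoeff_msupp.
  move/msupp_sum_le; rewrite filter_predT => /flatten_mapP[t _].
  case: (leqP j t) => [/Hw E|tj]; first by rewrite E mul0r msupp0.
  move/msuppM_le/allpairsP => [[m1 m2] /= [_]]; rewrite mxE msuppX inE => /eqP -> E.
  have [|i [q [t' [t'j lt Et']]]] := Hs t j; first by rewrite tj ltn_ord.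
  exists i.
    rewrite inE; apply/existsP; exists (Ordinal (ltn_trans t'j (ltn_ord j))).
    by rewrite t'j; apply/existsP; exists q; apply/eqP.
  by move/(congr1 (fun m : 'X_{1..n} => m i)): E; rewrite !mnmDE /u; lia.
case/varideal_decomp => c ->; rewrite scaler_suml.
apply: below_span_sum => i; rewrite inE => /existsP[t /andP[tj /existsP[q /eqP E]]].
rewrite -scalerA; apply: below_spanZ.
have -> : 'X_i *: row j D = 'X_q *: row t D.
  apply/matrixP => x y; rewrite !mxE -!mpolyXD; congr 'X_[_].
  by rewrite ![(U_(_) + _)%MM]addmC.
by apply: below_spanZ; exact: below_span_row.
Qed.

(** * Iterating syzygies into a resolution *)

Record resolution_stage := ResolutionStage {
  stage_cols : nat;
  stage_rows : nat;
  stage_mx : 'M[R]_(stage_rows, stage_cols);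
  stage_homog : exists e, forall i j, stage_mx i j \is e.-homog;
  stage_quotients : linear_quotients stage_mx }.

(** The number of rows is paired with the matrix so that one choice yields both and the next stage
    is a function. *)
Lemma stage_syzygy_exists (S : resolution_stage) :
  exists x : {m' : nat & 'M[R]_(m', stage_rows S)},
    [/\ forall i j, projT2 x i j \is 1%N.-homog,
        forall v : 'rV_(stage_rows S),
          v *m stage_mx S = 0 <-> exists w, v = w *m projT2 x &
        linear_quotients (projT2 x)].
Proof.
have [e homS] := stage_homog S.
have [m' [D' H]] := linear_quotients_syzygy homS (stage_quotients S).
by exists (existT _ m' D').
Qed.

Definition stage_syzygy (S : resolution_stage) :=
  constructive_indefinite_description _ (stage_syzygy_exists S).

Lemma stage_syzygy_homog (S : resolution_stage) :
  exists e, forall i j, projT2 (proj1_sig (stage_syzygy S)) i j \is e.-homog.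
Proof. by have [H _ _] := proj2_sig (stage_syzygy S); exists 1%N. Qed.

Lemma stage_syzygy_quotients (S : resolution_stage) :
  linear_quotients (projT2 (proj1_sig (stage_syzygy S))).
Proof. by have [_ _] := proj2_sig (stage_syzygy S). Qed.

Definition next_stage (S : resolution_stage) : resolution_stage :=
  ResolutionStage (stage_syzygy_homog S) (stage_syzygy_quotients S).

Lemma linear_quotients_resolution q m (g : 'cV[R]_m) (I : R -> Prop) :
  (forall j, g j 0 \is q.-homog) -> linear_quotients g ->
  (forall p, I p <-> exists v : 'rV_m, p = (v *m g) 0 0) ->
  has_linear_resolution q I.
Proof.
move=> homg lqg HI.
have homg' : exists e, forall i j, g i j \is e.-homog.
  by exists q => i j; rewrite (ord1 j).
pose S0 := ResolutionStage homg' lqg.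
pose S i := iter i next_stage S0.
have HS i := proj2_sig (stage_syzygy (S i)).
exists (fun i => stage_rows (S i)), g, (fun i => stage_mx (S i.+1)).
split=> // [i j k|v|i v].
- by have [H _ _] := HS i; exact: H.
- by have [_ H _] := HS 0%N; exact: H.
- by have [_ H _] := HS i.+1; exact: H.
Qed.

End LinearQuotients.

(** * Exchange between products of edges *)

Lemma mdeg_eq_exists_lt n (m1 m2 : 'X_{1..n}) :
  mdeg m1 = mdeg m2 -> m1 != m2 -> exists i, (m1 i < m2 i)%N.
Proof.
move=> dE ne; case: (pickP (fun i => m1 i < m2 i)%N) => [i lt|nlt]; first by exists i.
have le : (m2 <= m1)%MM by apply/mnm_lepP => i; rewrite leqNgt nlt.
have /eqP : mdeg (m1 - m2) = 0%N by move: (mdegD (m1 - m2) m2); rewrite submK // dE; lia.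
by rewrite mdeg_eq0 => /eqP E; case/eqP: ne; rewrite -(submK le) E add0m.
Qed.

Lemma addmCA n : left_commutative (@mnm_add n).
Proof. by move=> x y z; rewrite !addmA [(x + y)%MM]addmC. Qed.

Lemma addmAC n : right_commutative (@mnm_add n).
Proof. by move=> x y z; rewrite -!addmA [(y + z)%MM]addmC. Qed.

Section EdgeProducts.
Variables (n : nat) (T : eqType) (mon : T -> 'X_{1..n}) (E : {pred T}) (r : T -> nat).

Definition smon (M : seq T) : 'X_{1..n} := (\sum_(e <- M) mon e)%MM.

Lemma smon_cons e M : smon (e :: M) = (mon e + smon M)%MM.
Proof. exact: big_cons. Qed.

Lemma perm_smon M N : perm_eq M N -> smon M = smon N.
Proof. exact: perm_big. Qed.

Lemma smon_rem e M : e \in M -> smon M = (mon e + smon (rem e M))%MM.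
Proof. by move=> eM; rewrite (perm_smon (perm_to_rem eM)) smon_cons. Qed.

Lemma smon_gt0 M i : (0 < smon M i)%N -> exists2 e, e \in M & (0 < mon e i)%N.
Proof.
elim: M => [|e M IH]; first by rewrite /smon big_nil mnm0E.
rewrite smon_cons mnmDE addn_gt0 => /orP[ei|/IH[g gM gi]].
  by exists e; rewrite ?mem_head.
by exists g; rewrite // in_cons gM orbT.
Qed.

Lemma mon_le_smon e M i : e \in M -> (mon e i <= smon M i)%N.
Proof. by move=> /smon_rem ->; rewrite mnmDE leq_addr. Qed.

Hypothesis mon2 : forall e, e \in E -> exists a b, mon e = (U_(a) + U_(b))%MM.
Hypothesis r_inj : {in E &, injective r}.
(** Linear quotients for single edges: multiplying [e] by some variable [x] of [f] gives a multiple
    of a smaller edge. *)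
Hypothesis exch : forall e f, e \in E -> f \in E -> (r f < r e)%N ->
  exists h x y c, [/\ h \in E, (r h < r e)%N, (mon h + U_(c) = mon e + U_(x))%MM &
                      mon f = (U_(x) + U_(y))%MM].

Lemma mdeg_smon M : all (mem E) M -> mdeg (smon M) = (size M).*2.
Proof.
elim: M => [|e M IH] /=; first by rewrite /smon big_nil mdeg0.
case/andP=> /mon2[a [b Ee]] /IH EM; rewrite smon_cons mdegD EM Ee mdegD !mdeg1.
by rewrite doubleS.
Qed.

(** The second case is the exchange that linear quotients require; the first will be excluded by
    minimality of weight. *)
Definition improves (M N M' : seq T) : Prop :=
  smon M' = smon M \/
  exists i q, (smon M i < smon N i)%N /\ (smon M' + U_(q) = smon M + U_(i))%MM.

(* The induction follows an alternating path between the products [e :: M] and [N];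
   when the path ends, one copy of [e] has been traded for smaller edges. *)
Lemma exchange_top e M N :
  size N = (size M).+1 -> e \in E -> all (mem E) M -> all (mem E) N ->
  (forall g, g \in M -> (r g <= r e)%N) -> (forall f, f \in N -> (r f < r e)%N) ->
  exists M', [/\ size M' = size N, all (mem E) M', forall g, g \in M' -> (r g <= r e)%N,
                 (count_mem e M' <= count_mem e M)%N & improves (e :: M) N M'].
Proof.
have [k] := ubnP (size M); elim: k M N => // k IH M N sM sN eE ME NE Mle Nlt.
have dE : mdeg (smon (e :: M)) = mdeg (smon N).
  by rewrite !mdeg_smon ?sN //= ME andbT.
have ne f : f \in N -> (f == e) = false.
  by move/Nlt; apply: contraTF => /eqP ->; rewrite ltnn.
case: (smon (e :: M) =P smon N) => [EN|/eqP neq].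
  exists N; split=> // [g /Nlt/ltnW //||]; last by left.
  rewrite (_ : count_mem e N = 0%N) //.
  by apply/count_memPn; apply/negP => /ne; rewrite eqxx.
have [i lti] := mdeg_eq_exists_lt dE neq.
have [f fN fi] := smon_gt0 (leq_ltn_trans (leq0n _) lti).
have fE : f \in E := allP NE _ fN.
have [h [x [y [c [hE hlt Eh Ef]]]]] := exch eE fE (Nlt _ fN).
(* If [x] too is scarcer than in [N], replacing [e] by [h] is already the exchange. *)
case: (ltnP (smon (e :: M) x) (smon N x)) => [ltx|gex].
  exists (h :: M); split; rewrite /= ?sN ?ME ?andbT //.
  - by move=> g; rewrite in_cons => /orP[/eqP ->|/Mle //]; exact: ltnW.
  - by case: eqP hlt => [->|]; rewrite ?ltnn.
  - by right; exists x, c; split=> //; rewrite !smon_cons addmAC Eh addmAC.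
have {fi} yi : y = i.
  move: fi; rewrite Ef mnmDE !mnm1E.
  case: (x =P i) => [Ex|_]; first by move: gex; rewrite Ex; lia.
  by case: (y =P i).
subst y.
have fx : (0 < smon N x)%N.
  by apply: leq_trans (mon_le_smon x fN); rewrite Ef mnmDE mnm1E eqxx.
(* As [N] contains [x] and [e :: M] has no fewer copies, some edge [g] there contains [x]. With [g]
   joining [x] and [j], trading [g] for [f] trades [j] for [i]. *)
have [g gM gx] := smon_gt0 (leq_trans fx gex).
have gE : g \in E by move: gM; rewrite in_cons => /orP[/eqP -> //|]; exact: (allP ME).
have {gx} [j Eg] : exists j, mon g = (U_(x) + U_(j))%MM.
  have [a [b Eab]] := mon2 gE; move: gx; rewrite Eab mnmDE !mnm1E.
  case: (a =P x) => [->|_]; first by exists b.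
  by case: (b =P x) => [->|//]; exists a; rewrite addmC.
have Efg : (mon f + U_(j) = mon g + U_(i))%MM by rewrite Ef Eg addmAC.
move: gM; rewrite in_cons => /orP[/eqP ge|gM].
  subst g; exists (f :: M); split; rewrite /= ?sN ?ME ?andbT //.
  - by move=> g; rewrite in_cons => /orP[/eqP ->|/Mle //]; exact: ltnW (Nlt _ fN).
  - by rewrite ne.
  - by right; exists i, j; split=> //; rewrite !smon_cons addmAC Efg addmAC.
have sM1 : size M = (size (rem g M)).+1 by have := perm_size (perm_to_rem gM).
have sN1 : size N = (size (rem f N)).+1 by have := perm_size (perm_to_rem fN).
(* Unless [g] is [e], both [g] and [f] are set aside and the path continues in the smaller
   products. *)
have [||||||M1 [s1 M1E M1le M1c M1i]] := IH (rem g M) (rem f N) _ _ eE.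
- by move: sM; rewrite sM1.
- by move: sN; rewrite sN1 sM1 => -[].
- by apply/allP => t /mem_rem /(allP ME).
- by apply/allP => t /mem_rem /(allP NE).
- by move=> t /mem_rem /Mle.
- by move=> t /mem_rem /Nlt.
have EM : smon (e :: M) = (mon g + smon (e :: rem g M))%MM.
  by rewrite !smon_cons (smon_rem gM) addmCA.
have Mc : count_mem e M = ((g == e) + count_mem e (rem g M))%N.
  by rewrite (permP (perm_to_rem gM)).
have good t : t \in E -> (r t <= r e)%N -> ((t == e) <= (g == e))%N ->
    improves (e :: M) N (t :: M1) ->
  exists M', [/\ size M' = size N, all (mem E) M', forall g, g \in M' -> (r g <= r e)%N,
               (count_mem e M' <= count_mem e M)%N & improves (e :: M) N M'].
  move=> tE tr tg ti; exists (t :: M1); split; rewrite //= ?s1 ?sN1 ?M1E ?andbT //.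
  - by move=> t'; rewrite in_cons => /orP[/eqP ->|/M1le].
  - by rewrite Mc; exact: leq_add.
case: M1i => [E1|[i1 [q [lt1 E1]]]].
  apply: (good g) => //; first exact: Mle.
  by left; rewrite EM smon_cons E1.
(* If the exchange found there brings in [j], trading [g] for [f] turns it into one for [i].
   Otherwise [g] stays and [i1] is still scarcer than in [N], since [g] can exceed [f] only at
   [j]. *)
case: (j =P i1) => [Ej|nj].
  apply: (good f); [by [] | exact: ltnW (Nlt _ fN) | by rewrite (ne f) |].
  right; exists i, q; split=> //.
  by rewrite EM smon_cons -addmA E1 -Ej addmCA Efg addmCA addmA.
apply: (good g) => //; first exact: Mle.
right; exists i1, q; split; last by rewrite EM smon_cons -addmA E1 addmA.
rewrite EM (smon_rem fN) !mnmDE Eg Ef !mnmDE !mnm1E; move: lt1 nj.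
by case: (j =P i1) => //; rewrite /=; lia.
Qed.

Lemma exists_max_rank M : M != [::] ->
  exists2 e, e \in M & forall g, g \in M -> (r g <= r e)%N.
Proof.
elim: M => // e [|e' M] IH _; first by exists e; rewrite ?mem_head // => g /[!inE] /eqP ->.
have [//|g gM gmax] := IH; case: (leqP (r g) (r e)) => [le|lt].
  exists e; rewrite ?mem_head // => h; rewrite in_cons => /orP[/eqP -> //|/gmax].
  by move=> hg; exact: leq_trans le.
exists g; first by rewrite in_cons gM orbT.
by move=> h; rewrite in_cons => /orP[/eqP ->|/gmax //]; exact: ltnW.
Qed.

(** * Weights of edge products *)

Variable k : nat.

(* For products of at most [k] edges this compares multiplicities lexicographically,
   starting from the edge of largest rank. *)
Definition weight (M : seq T) : nat := (\sum_(e <- M) k.+1 ^ r e)%N.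

Lemma weight_cons e M : weight (e :: M) = (k.+1 ^ r e + weight M)%N.
Proof. exact: big_cons. Qed.

Lemma weight_rem e M : e \in M -> weight M = (k.+1 ^ r e + weight (rem e M))%N.
Proof. by move=> eM; rewrite -weight_cons; apply: perm_big; exact: perm_to_rem. Qed.

(** Scaled by [k.+1], a copy of [e] counts [k.+1] times [k.+1 ^ r e] and any other edge at most
    once, its rank being strictly smaller. *)
Lemma weight_bound e M : e \in E -> all (mem E) M ->
  (forall g, g \in M -> (r g <= r e)%N) ->
  (k.+1 * weight M <= (count_mem e M * k + size M) * k.+1 ^ r e)%N.
Proof.
move=> eE; elim: M => [|g M IH]; first by rewrite /weight big_nil muln0.
case/andP=> gE ME Mle; rewrite weight_cons /=.
have {}IH : (k.+1 * weight M <= (count_mem e M * k + size M) * k.+1 ^ r e)%N.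
  by apply: IH => // t tM; apply: Mle; rewrite in_cons tM orbT.
case: (g =P e) => [->|ge] /=; first by nia.
have lt : (r g < r e)%N.
  rewrite ltn_neqAle Mle ?mem_head // andbT.
  by apply/eqP => /(r_inj gE eE).
have : (k.+1 * k.+1 ^ r g <= k.+1 ^ r e)%N by rewrite -expnS leq_pexp2l.
nia.
Qed.

(** Common edges are cancelled first. Then the largest edge [e] of [M] outranks all of [N], and
    trading a copy of [e] for smaller edges lowers the weight. *)
Lemma weight_exchange M N :
  size M = size N -> (size M <= k)%N -> all (mem E) M -> all (mem E) N ->
  (weight N <= weight M)%N -> ~~ perm_eq M N ->
  exists M', [/\ size M' = size M, all (mem E) M', (weight M' < weight M)%N &
                 improves M N M'].
Proof.
have [c] := ubnP (size M); elim: c M N => // c IH M N sc sMN sk ME NE wle nperm.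
case: (altP (@hasP _ (mem N) M)) => [[g gM gN]|/hasPn disj].
  have pM := perm_to_rem gM; have pN := perm_to_rem gN.
  have sM1 : size M = (size (rem g M)).+1 by have := perm_size pM.
  have sN1 : size N = (size (rem g N)).+1 by have := perm_size pN.
  have gE : g \in E := allP ME _ gM.
  have [|||||||M1 [s1 M1E w1 i1]] := IH (rem g M) (rem g N).
  - by move: sc; rewrite sM1.
  - by move: sMN; rewrite sM1 sN1 => -[].
  - by move: sk; rewrite sM1; exact: ltnW.
  - by apply/allP => t /mem_rem /(allP ME).
  - by apply/allP => t /mem_rem /(allP NE).
  - by move: wle; rewrite (weight_rem gM) (weight_rem gN) leq_add2l.
  - apply: contra nperm => p1; rewrite (perm_trans pM) // perm_sym (perm_trans pN) //.
    by rewrite perm_cons perm_sym.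
  exists (g :: M1); split; rewrite /= ?s1 ?M1E ?andbT //.
    by rewrite weight_cons (weight_rem gM) ltn_add2l.
  case: i1 => [E1|[i [q [lt E1]]]]; first by left; rewrite smon_cons E1 -smon_rem.
  right; exists i, q; rewrite (smon_rem gM) (smon_rem gN) smon_cons !mnmDE.
  by rewrite ltn_add2l -addmA E1 addmA.
have M0 : M != [::] by apply: contra nperm => /eqP M0; move: sMN; rewrite M0; case: (N).
have [e eM emax] := exists_max_rank M0.
have eE : e \in E := allP ME _ eM; have pM := perm_to_rem eM.
have sM1 : size M = (size (rem e M)).+1 by have := perm_size pM.
have B0 : (0 < k.+1 ^ r e)%N by rewrite expn_gt0.
have cM : (count_mem e M <= size M)%N by exact: count_size.
have bM := weight_bound eE ME emax.
have wM : (weight M <= k * k.+1 ^ r e)%N.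
  by rewrite -(leq_pmul2l (ltn0Sn k)); apply: leq_trans bM _; nia.
(* A larger edge in [N] would alone outweigh [M], which has at most [k] edges; [e] itself is
   excluded by disjointness. *)
have Nlt f : f \in N -> (r f < r e)%N.
  move=> fN; rewrite ltnNge leq_eqVlt; apply/negP => /orP[/eqP Ef|lt].
    have Efe := r_inj eE (allP NE _ fN) Ef.
    by have /negP[] := disj _ eM; rewrite Efe.
  have : (k.+1 * k.+1 ^ r e <= k.+1 ^ r f)%N by rewrite -expnS leq_pexp2l.
  have := weight_rem fN; nia.
have [|||M' [s' M'E M'le cM' imp]] := @exchange_top e (rem e M) N _ eE _ NE _ Nlt.
- by rewrite -sMN.
- by apply/allP => t /mem_rem /(allP ME).
- by move=> t /mem_rem /emax.
exists M'; split=> //; first by rewrite s' sMN.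
  (* [M'] has fewer copies of [e] than [M], and at most [k] edges of smaller rank weigh less than
     one copy. *)
  have bM' := weight_bound eE M'E M'le.
  have cE : count_mem e M = (count_mem e (rem e M)).+1.
    by rewrite (permP pM) /= eqxx.
  have : (count_mem e M * k.+1 ^ r e <= weight M)%N.
    rewrite /weight -sum1_count big_distrl /= [X in (_ <= X)%N](bigID (pred1 e)) /=.
    rewrite -[X in (X <= _)%N]addn0; apply: leq_add => //.
    by apply: eq_leq; apply: eq_bigr => t /eqP ->; rewrite mul1n.
  rewrite -(ltn_pmul2l (ltn0Sn k)) cE => wM'.
  have sk' : (size M' <= k)%N by rewrite s' -sMN.
  apply: leq_ltn_trans bM' _; apply: leq_trans (leq_mul (leqnn k.+1) wM').
  rewrite mulnA ltn_pmul2r //; nia.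
by move: imp; rewrite /improves -(perm_smon pM).
Qed.

(** * Minimal products and the order on generators *)

Definition divisor_product (z : 'X_{1..n}) (M : seq T) : Prop :=
  [/\ size M = k, all (mem E) M & (smon M <= z)%MM].

Lemma min_weight_exists z : exists w, (exists M, divisor_product z M) ->
  (exists2 M, divisor_product z M & weight M = w) /\
  (forall M, divisor_product z M -> (w <= weight M)%N).
Proof.
case: (excluded_middle_informative (exists M, divisor_product z M)) => [[M HM]|no];
  last by exists 0%N.
have [w] := ubnP (weight M); elim: w M HM => // w IH M HM ltw.
case: (excluded_middle_informative
         (exists2 M', divisor_product z M' & (weight M' < weight M)%N)) => [[M' HM' lt]|no].
  by apply: (IH M' HM'); lia.
exists (weight M) => _; split; first by exists M.
by move=> M' HM'; rewrite leqNgt; apply/negP => lt; apply: no; exists M'.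
Qed.

Definition min_weight z : nat :=
  proj1_sig (constructive_indefinite_description _ (min_weight_exists z)).

Lemma min_weightP z M : divisor_product z M ->
  exists2 N, divisor_product z N & weight N = min_weight z.
Proof.
move=> HM; rewrite /min_weight; case: constructive_indefinite_description => w /= H.
by have [] := H (ex_intro _ M HM).
Qed.

Lemma min_weight_le z M : divisor_product z M -> (min_weight z <= weight M)%N.
Proof.
move=> HM; rewrite /min_weight; case: constructive_indefinite_description => w /= H.
by have [_] := H (ex_intro _ M HM); apply.
Qed.

(** Ties go to the larger monomial, which for equal degrees is the lexicographically larger one. *)
Definition before (z z' : 'X_{1..n}) : bool :=
  (min_weight z < min_weight z')%N ||
  (min_weight z == min_weight z') && (z' <= z)%O.

Lemma before_total : total before.
Proof.
move=> z z'; rewrite /before; case: (ltngtP (min_weight z)) => //= _.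
by rewrite orbC le_total.
Qed.

Lemma before_trans : transitive before.
Proof.
move=> z y x; rewrite /before => /orP[lt1|/andP[/eqP-> le1]] /orP[lt2|/andP[/eqP<- le2]].
- by rewrite (ltn_trans lt1 lt2).
- by rewrite lt1.
- by rewrite lt2.
- by rewrite eqxx (le_trans le2 le1) orbT.
Qed.

Lemma before_exchange D (z z' : 'X_{1..n}) :
  mdeg z = D -> mdeg z' = D -> (forall i, z i <= k)%N -> (forall i, z' i <= k)%N ->
  (exists M, divisor_product z M) -> (exists M, divisor_product z' M) ->
  before z' z -> z' != z ->
  exists i q w, [/\ (z i < z' i)%N /\ (w + U_(q) = z + U_(i))%MM, mdeg w = D,
    (forall i, w i <= k)%N, (exists M, divisor_product w M) & ~~ before z w].
Proof.
move=> dz dz' zk z'k [M0 /min_weightP[M [sM ME Mz] wM]].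
move=> [N0 /min_weightP[N [sN NE Nz'] wN]] bz nz.
have Mz_ i := mnm_lepP Mz i; have Nz'_ i := mnm_lepP Nz' i.
suff [i [q [M' [lt qz M'z nb]]]] : exists i q M', [/\ (z i < z' i)%N, (U_(q) <= z + U_(i))%MM,
    divisor_product (z + U_(i) - U_(q))%MM M' & ~~ before z (z + U_(i) - U_(q))%MM].
  exists i, q, (z + U_(i) - U_(q))%MM; split=> //; last by exists M'.
  - by split=> //; exact: submK.
  - by have := mdegD (z + U_(i) - U_(q)) U_(q); rewrite submK // mdegD !mdeg1; lia.
  move=> p; rewrite mnmBE mnmDE !mnm1E.
  by have := zk p; have := z'k i; case: (i =P p) => [<-|_] /=; lia.
have [pMN|npMN] := boolP (perm_eq M N).
  have wMN : min_weight z = min_weight z' by rewrite -wM -wN; exact: perm_big.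
  have sMN := perm_smon pMN.
  have ltz : (z < z')%O.
    move: bz; rewrite /before wMN ltnn eqxx /= => le.
    by rewrite lt_neqAle le eq_sym nz.
  have /(ltmcP (etrans dz (esym dz')))[i eqi lti] := ltz.
  have [q ltq] : exists q, (z' q < z q)%N.
    by apply: mdeg_eq_exists_lt; rewrite ?dz ?dz'.
  have iq : (i < q)%N.
    rewrite ltnNge leq_eqVlt; apply/negP => /orP[/eqP/ord_inj E'|lt].
      by move: ltq lti; rewrite E'; lia.
    by move: ltq; rewrite eqi // ltnn.
  exists i, q, M; split=> //.
  - by apply/mnm_lepP => p; rewrite mnmDE !mnm1E; case: (q =P p) => [<-|_] /=; lia.
  - split=> //; apply/mnm_lepP => p; rewrite mnmBE mnmDE !mnm1E.
    have := Mz_ p; have := Nz'_ p; rewrite -sMN.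
    by case: (q =P p) => [<-|_] /=; lia.
  rewrite /before negb_or negb_and -!leqNgt -ltNge.
  set w := (z + U_(i) - U_(q))%MM.
  have wle : (min_weight w <= min_weight z)%N.
    rewrite -wM; apply: min_weight_le; split=> //.
    apply/mnm_lepP => p; rewrite mnmBE mnmDE !mnm1E.
    have := Mz_ p; have := Nz'_ p; rewrite -sMN.
    by case: (q =P p) => [<-|_] /=; lia.
  rewrite wle /=; apply/orP; right.
  apply/ltmcP.
    have := mdegD w U_(q); rewrite submK ?mdegD ?mdeg1; first by lia.
    by apply/mnm_lepP => p; rewrite mnmDE !mnm1E; case: (q =P p) => [<-|_] /=; lia.
  exists i => [j ji|]; rewrite mnmBE mnmDE !mnm1E -!val_eqE /=.
    by rewrite !gtn_eqF ?addn0 ?subn0 // (ltn_trans ji iq).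
  by rewrite eqxx gtn_eqF // subn0 addn1.
have wNM : (weight N <= weight M)%N.
  by rewrite wN wM; move: bz => /orP[/ltnW //|/andP[/eqP-> _]].
have [||M' [sM' M'E wM' imp]] := weight_exchange _ _ ME NE wNM npMN.
- by rewrite sM sN.
- by rewrite sM.
(* By the choice of [M], no product of smaller weight divides [z]. This excludes equal products and
   forces the exponent of [z] at [i] below that of [N]. *)
have min' : ~ (smon M' <= z)%MM.
  move=> le; have : (min_weight z <= weight M')%N by apply: min_weight_le; split; rewrite ?sM'.
  by rewrite -wM leqNgt wM'.
case: imp => [E'|[i [q [lt E']]]]; first by case: min'; rewrite E'.
have E_ p : (smon M' p + (q == p) = smon M p + (i == p))%N.
  by have := congr1 (fun m : 'X_{1..n} => m p) E'; rewrite /= !mnmDE !mnm1E.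
have lti : (z i < smon N i)%N.
  rewrite ltnNge; apply/negP => le; apply: min'; apply/mnm_lepP => p.
  by have := E_ p; have := Mz_ p; case: (i =P p) => [<-|_] /=; lia.
have dw : divisor_product (z + U_(i) - U_(q))%MM M'.
  split; rewrite ?sM' //; apply/mnm_lepP => p; rewrite mnmBE mnmDE !mnm1E.
  by have := E_ p; have := Mz_ p; lia.
exists i, q, M'; split=> //.
- exact: leq_trans lti (Nz'_ i).
- apply/mnm_lepP => p; rewrite mnmDE !mnm1E.
  by have := E_ p; have := Mz_ p; lia.
have := min_weight_le dw; rewrite /before negb_or negb_and -!leqNgt => le.
have lt' : (min_weight (z + U_(i) - U_(q))%MM < min_weight z)%N.
  by apply: leq_ltn_trans le _; rewrite -wM.
by rewrite (ltnW lt') gtn_eqF.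
Qed.

(** Sorting by [before] turns the exchange into positions: a monomial strictly before the [j]-th one
    has a smaller index. *)
Lemma sorted_exchange D (Z : seq 'X_{1..n}) :
  uniq Z ->
  (forall z, z \in Z <->
     [/\ mdeg z = D, forall i, (z i <= k)%N & exists M, divisor_product z M]) ->
  exists2 s, s =i Z & forall t j, (t < j < size s)%N -> exists i q t',
     [/\ (t' < j)%N, (nth 0%MM s j i < nth 0%MM s t i)%N &
         (nth 0%MM s t' + U_(q) = nth 0%MM s j + U_(i))%MM].
Proof.
move=> uZ HZ; exists (sort before Z); first exact: mem_sort.
set s := sort _ _; have us : uniq s by rewrite sort_uniq.
have ss : sorted before s by exact: sort_sorted before_total Z.
have refl : reflexive before by move=> z; have := before_total z z; rewrite orbb.
have le t j : (t < size s)%N -> (j < size s)%N -> (t <= j)%N ->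
    before (nth 0%MM s t) (nth 0%MM s j).
  by move=> ts js tj; apply: (sorted_leq_nth before_trans refl 0%MM ss); rewrite ?inE.
have memZ t : (t < size s)%N -> nth 0%MM s t \in Z.
  by move=> ts; rewrite -(mem_sort before) mem_nth.
move=> t j /andP[tj js]; have ts := ltn_trans tj js.
have [dz zk Mz] := (HZ _).1 (memZ _ js).
have [dz' z'k Mz'] := (HZ _).1 (memZ _ ts).
have [|i [q [w [[lt Ew] dw wk Mw nb]]]] :=
    before_exchange dz dz' zk z'k Mz Mz' (le _ _ ts js (ltnW tj)).
  by rewrite nth_uniq // ltn_eqF.
have ws : w \in s by rewrite mem_sort; apply/HZ.
exists i, q, (index w s); rewrite nth_index //; split=> //.
rewrite ltnNge; apply/negP => /(le _ _ js); rewrite index_mem nth_index // => /(_ ws).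
by apply/negP.
Qed.

End EdgeProducts.

(** * Quasi-trees and their nonedges *)

Lemma face_in_facet n (Delta : {set {set 'I_n}}) F :
  F \in Delta -> exists2 G, is_facet Delta G & F \subset G.
Proof.
move=> FD; have [G /maxsetP[GD Gmax] FG] := @maxset_exists _ (mem Delta) F FD.
by exists G => //; split=> // H HD GH; exact: Gmax.
Qed.

Lemma quasi_tree_elimination n (Delta : {set {set 'I_n}}) :
  is_simplicial_complex Delta -> is_quasi_tree Delta ->
  exists (tau : 'I_n -> nat) (F : nat -> {set 'I_n}),
    (forall v, F (tau v) \in Delta) /\
    (forall v w, [set v; w] \in Delta -> (tau w <= tau v)%N -> w \in F (tau v)).
Proof.
move=> [D1 DS] [s [us Hs leaf]].
pose tau v := find (fun F : {set 'I_n} => v \in F) s; pose F := nth set0 s.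
have has_v v : has (fun F : {set 'I_n} => v \in F) s.
  have [G /Hs Gs vG] := face_in_facet (D1 v).
  by apply/hasP; exists G => //; apply: (subsetP vG); rewrite inE.
have tau_lt v : (tau v < size s)%N by rewrite -has_find.
have vF v : v \in F (tau v) by exact: (nth_find set0 (has_v v)).
exists tau, F; split=> [v|v w vwD le].
  by have /Hs[] := mem_nth set0 (tau_lt v).
have [G /Hs Gs vwG] := face_in_facet vwD.
have [i [si vi wi]] : exists i, [/\ (i < size s)%N, v \in F i & w \in F i].
  exists (index G s); rewrite index_mem /F nth_index //.
  by split=> //; apply: (subsetP vwG); rewrite !inE eqxx ?orbT.
(* The pair descends along the leaf order: if [F i] is not the first facet of [v], then [v] and [w]
   both lie in earlier facets, so the branch [G'] of the leaf [F i] contains both. *)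
elim/ltn_ind: i si vi wi => i IH si vi wi.
have tv : (tau v <= i)%N by rewrite leqNgt; apply/negP => /(before_find set0); rewrite vi.
have [-> //|ne] := eqVneq (tau v) i.
have {ne tv} ltv : (tau v < i)%N by rewrite ltn_neqAle ne.
have ltw := leq_ltn_trans le ltv.
have memt t : (t < i)%N -> F t \in take i.+1 s.
  move=> ti; have ti1 := leq_trans ti (leqnSn i).
  by rewrite /F -(nth_take set0 ti1) mem_nth // size_takel.
have neF t : (t < i)%N -> F t != F i.
  by move=> ti; rewrite /F nth_uniq ?(ltn_trans ti si) // neq_ltn ti.
have [_ [all1|[G' [G's G'F G'leaf]]]] := leaf i si.
  by have /eqP := all1 _ (memt _ ltv); rewrite (negPf (neF _ ltv)).
have sub t x : (t < i)%N -> x \in F t -> x \in F i -> x \in G'.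
  move=> ti xt xi; have /subsetP/(_ x) := G'leaf _ (memt _ ti) (neF _ ti).
  by rewrite !inE xt xi => /(_ isT)/andP[].
have Gi : (index G' (take i.+1 s) < i)%N.
  rewrite ltn_neqAle; apply/andP; split.
    apply/eqP => E; case/eqP: G'F; rewrite -(nth_index set0 G's) E nth_take //.
  rewrite -ltnS; apply: leq_trans (_ : size (take i.+1 s) <= _)%N.
    by rewrite index_mem.
  by rewrite size_takel.
have EG : F (index G' (take i.+1 s)) = G'.
  by rewrite /F -(nth_take set0 (leq_trans Gi (leqnSn i))) nth_index.
apply: (IH _ Gi); rewrite ?EG; first exact: ltn_trans si.
  exact: sub ltv (vF v) vi.
exact: sub ltw (vF w) wi.
Qed.

Definition set_mon n (F : {set 'I_n}) : 'X_{1..n} := [multinom (i \in F : nat) | i < n].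

Lemma mdeg_set_mon n (F : {set 'I_n}) : mdeg (set_mon F) = #|F|.
Proof.
rewrite mdegE -sum1_card [RHS]big_mkcond /=; apply: eq_bigr => i _.
by rewrite mnmE; case: (_ \in _).
Qed.

Lemma xF_set_mon n (K : fieldType) (F : {set 'I_n}) : xF K F = 'X_[set_mon F].
Proof.
rewrite mpolyXE_id /xF big_mkcond; apply: eq_bigr => i _.
by rewrite mnmE; case: (_ \in _).
Qed.

(** * Nonedges along the elimination order *)

Section NonedgeProducts.
Variables (n : nat) (Delta : {set {set 'I_n}}) (tau : 'I_n -> nat) (Fac : nat -> {set 'I_n}).
Hypothesis complex : is_simplicial_complex Delta.
Hypothesis Fac_face : forall v, Fac (tau v) \in Delta.
Hypothesis Fac_nbr : forall v w,
  [set v; w] \in Delta -> (tau w <= tau v)%N -> w \in Fac (tau v).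

(* Vertices with the same [tau] lie in a common facet, so every pair outside [Delta]
   has exactly one orientation in [nonedge]. *)
Definition nonedge : {pred 'I_n * 'I_n} :=
  [pred e | ([set e.1; e.2] \notin Delta) && (tau e.2 < tau e.1)%N].

Definition edge_mon (e : 'I_n * 'I_n) : 'X_{1..n} := (U_(e.1) + U_(e.2))%MM.

(** Large [tau] comes first, as in the elimination order: the neighbours of [v] with no larger [tau]
    lie in one face. The index breaks ties. *)
Definition vertex_rank (v : 'I_n) : nat := ((\max_u tau u - tau v) * n + v)%N.

Definition edge_rank (e : 'I_n * 'I_n) : nat := (vertex_rank e.1 * n + e.2)%N.

Lemma edge_mon_pair e : e \in nonedge -> exists a b, edge_mon e = (U_(a) + U_(b))%MM.
Proof. by exists e.1, e.2. Qed.

Lemma tau_max v : (tau v <= \max_u tau u)%N.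
Proof. exact: leq_bigmax. Qed.

Lemma vertex_rank_inj : injective vertex_rank.
Proof.
move=> u v /(congr1 (modn^~ n)); rewrite /vertex_rank !modnMDl !modn_small //.
exact: ord_inj.
Qed.

Lemma vertex_rank_tau u v : (vertex_rank u <= vertex_rank v)%N -> (tau v <= tau u)%N.
Proof.
rewrite /vertex_rank => E; have := ltn_ord u; have := ltn_ord v.
by have := tau_max u; have := tau_max v; nia.
Qed.

Lemma edge_rank_inj : {in nonedge &, injective edge_rank}.
Proof.
move=> [a b] [a' b'] _ _; rewrite /edge_rank /= => E.
have := ltn_ord b; have := ltn_ord b' => lb lb'.
have Ea : vertex_rank a = vertex_rank a' by nia.
rewrite (vertex_rank_inj Ea); congr pair; apply: ord_inj.
by move: E; rewrite Ea; lia.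
Qed.

Lemma edge_rank_lt a b a' b' :
  (vertex_rank a' < vertex_rank a)%N -> (edge_rank (a', b') < edge_rank (a, b))%N.
Proof. by rewrite /edge_rank /=; have := ltn_ord b; have := ltn_ord b'; nia. Qed.

Lemma mem_Fac v : v \in Fac (tau v).
Proof. by apply: Fac_nbr => //; rewrite setUid; have [] := complex. Qed.

Lemma pair_face a b v : a \in Fac (tau v) -> b \in Fac (tau v) -> [set a; b] \in Delta.
Proof.
by have [_ DS] := complex => aF bF; apply: DS (Fac_face v) _; rewrite subUset !sub1set aF.
Qed.

Lemma nonedge_tau a b : [set a; b] \notin Delta -> tau a != tau b.
Proof.
apply: contra => /eqP E; have bF := mem_Fac b; rewrite -E in bF.
exact: pair_face (mem_Fac a) bF.
Qed.

(** If the first endpoints agree, the second one is exchanged. Otherwise [a'] is eliminated before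
    [a] and [b]; its later neighbours form a face, so [a'] is not adjacent to both ends of the
    nonedge [(a, b)]. *)
Lemma nonedge_exchange e f : e \in nonedge -> f \in nonedge ->
  (edge_rank f < edge_rank e)%N ->
  exists h x y c, [/\ h \in nonedge, (edge_rank h < edge_rank e)%N,
    (edge_mon h + U_(c) = edge_mon e + U_(x))%MM & edge_mon f = (U_(x) + U_(y))%MM].
Proof.
case: e f => [a b] [a' b'] /=; rewrite !inE /= => /andP[abD ltab] /andP[abD' ltab'] lt.
case: (a' =P a) => [E|/eqP ne].
  subst a'; exists (a, b'), b', a, b; split=> //; rewrite ?inE ?abD' //.
    by rewrite /edge_mon /= addmAC.
  by rewrite /edge_mon addmC.
have lta : (vertex_rank a' < vertex_rank a)%N.
  rewrite ltn_neqAle; apply/andP; split.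
    by apply: contra ne => /eqP/vertex_rank_inj ->.
  by move: lt; rewrite /edge_rank /=; have := ltn_ord b; have := ltn_ord b'; nia.
have le := vertex_rank_tau (ltnW lta).
have [aD|naD] := boolP ([set a'; a] \in Delta).
  have nbD : [set a'; b] \notin Delta.
    apply: contra abD => bD; apply: (@pair_face _ _ a'); apply: Fac_nbr => //; lia.
  exists (a', b), a', b', a; split=> //; first by rewrite inE /= nbD; lia.
    exact: edge_rank_lt.
  by apply/mnmP => p; rewrite /edge_mon /= !mnmDE; lia.
exists (a', a), a', b', b; split=> //; last first.
- by apply/mnmP => p; rewrite /edge_mon /= !mnmDE; lia.
- exact: edge_rank_lt.
by rewrite inE /= naD ltn_neqAle le andbT eq_sym nonedge_tau.
Qed.

(** Take [v] in [F] of largest [tau]: a vertex of [F] outside the face [Fac (tau v)] is not adjacent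
    to [v]. *)
Lemma nonface_nonedge F : F \notin Delta -> F != set0 ->
  exists2 e, e \in nonedge & (e.1 \in F) && (e.2 \in F).
Proof.
move=> FD /set0Pn[v0 v0F]; have [v vF vmax] := arg_maxnP tau v0F.
have /subsetPn[w wF wN] : ~~ (F \subset Fac (tau v)).
  by apply: contra FD; have [_ DS] := complex; exact: DS.
have le : (tau w <= tau v)%N by exact: vmax.
have vwD : [set v; w] \notin Delta by apply: contra wN => /Fac_nbr; exact.
exists (v, w); last by apply/andP; split.
rewrite inE /= vwD ltn_neqAle le andbT eq_sym.
exact: nonedge_tau.
Qed.

(** * Distributing variables over nonedges *)

Definition has_nonedge (B : {set 'I_n}) : bool :=
  [exists e : 'I_n * 'I_n, [&& e \in nonedge, e.1 \in B & e.2 \in B]].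

Lemma has_nonedgeS (B C : {set 'I_n}) : B \subset C -> has_nonedge B -> has_nonedge C.
Proof.
move=> /subsetP BC /existsP[e /and3P[eE e1 e2]].
by apply/existsP; exists e; rewrite eE !BC.
Qed.

Lemma has_nonedge_notin B : has_nonedge B -> B \notin Delta.
Proof.
move=> /existsP[e /and3P[/andP[eD _] e1 e2]]; apply: contra eD => BD.
by have [_ DS] := complex; apply: DS BD _; rewrite subUset !sub1set e1.
Qed.

(** Start with the endpoints of the [k] nonedges. A variable not yet used up has exponent at most
    [k] in [z], so some [B j] lacks it and can take it. *)
Lemma nonedge_fill k (z : 'X_{1..n}) (M : seq ('I_n * 'I_n)) :
  size M = k -> all (mem nonedge) M -> (smon edge_mon M <= z)%MM -> (forall i, z i <= k)%N ->
  exists2 B : 'I_k -> {set 'I_n}, forall j, has_nonedge (B j) &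
    z = (\sum_j set_mon (B j))%MM.
Proof.
move=> sM ME Mz zk.
have [B0 gB0 leB0] : exists2 B : 'I_k -> {set 'I_n}, forall j, has_nonedge (B j) &
    (\sum_j set_mon (B j) <= z)%MM.
  subst k; pose e j := tnth (in_tuple M) j.
  exists (fun j => [set (e j).1; (e j).2]) => [j|].
    apply/existsP; exists (e j); rewrite !inE !eqxx orbT !andbT.
    by have := allP ME _ (mem_tnth j (in_tuple M)); rewrite inE.
  apply/mnm_lepP => i; apply: leq_trans (mnm_lepP Mz i).
  rewrite /smon (big_tnth _ _ M) !mnm_sumE; apply: leq_sum => j _.
  rewrite mnmE !inE mnmDE !mnm1E ![i == _]eq_sym.
  by rewrite -/(e j); case: (_ == i); case: (_ == i).
have [c] := ubnP (mdeg (z - \sum_j set_mon (B0 j))%MM).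
elim: c B0 gB0 leB0 => // c IH B gB leB ltc.
have [E|ne] := eqVneq z (\sum_j set_mon (B j))%MM; first by exists B.
have [i lti] : exists i, ((\sum_j set_mon (B j))%MM i < z i)%N.
  case: (pickP (fun i => ((\sum_j set_mon (B j))%MM i < z i)%N)) => [i|nlt]; first by exists i.
  case/eqP: ne; apply/mnmP => i; apply/eqP; rewrite eqn_leq (mnm_lepP leB) andbT.
  by rewrite leqNgt nlt.
have [j0 ij0] : exists j, i \notin B j.
  apply/existsP; apply: contraTT lti; rewrite negb_exists => /forallP H.
  rewrite -leqNgt mnm_sumE (eq_bigr (fun=> 1%N)); last first.
    by move=> j _; rewrite mnmE (negbNE (H j)).
  by rewrite sum1_card card_ord.
pose B' j := if j == j0 then i |: B j else B j.
have EB' : (\sum_j set_mon (B' j) = U_(i) + \sum_j set_mon (B j))%MM.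
  rewrite (bigD1 j0) //= [in RHS](bigD1 j0) //= addmA; congr (_ + _)%MM.
    apply/mnmP => p; rewrite /B' eqxx mnmDE !mnmE !inE eq_sym.
    by case: (i =P p) => [<-|_]; rewrite ?(negPf ij0).
  by apply: eq_bigr => j /negPf nj; rewrite /B' nj.
have leB' : (\sum_j set_mon (B' j) <= z)%MM.
  rewrite EB'; apply/mnm_lepP => p; rewrite mnmDE mnm1E.
  by have := mnm_lepP leB p; case: (i =P p) => [<-|_] //=; lia.
apply: (IH B') => // [j|].
  rewrite /B'; case: ifP => _ //; apply: has_nonedgeS (gB j); exact: subsetUr.
have := mdegD (z - \sum_j set_mon (B' j)) (\sum_j set_mon (B' j)).
have := mdegD (z - \sum_j set_mon (B j)) (\sum_j set_mon (B j)).
by rewrite !submK // EB' mdegD mdeg1; lia.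
Qed.

(* If the small set lies in the large one, its nonedge survives the move of any
   vertex; otherwise the large set has three vertices to choose from, one of them
   off a given nonedge. *)
Lemma nonedge_balance k l (B0 : 'I_k -> {set 'I_n}) :
  (forall j, has_nonedge (B0 j)) -> (\sum_j #|B0 j| = k * l)%N ->
  exists B : 'I_k -> {set 'I_n}, [/\ forall j, has_nonedge (B j), forall j, #|B j| = l &
    (\sum_j set_mon (B j) = \sum_j set_mon (B0 j))%MM].
Proof.
(* Moving a vertex from a set with more than [l] elements to one with fewer lowers the sum of
   squares. *)
have [c] := ubnP (\sum_j #|B0 j| ^ 2)%N; elim: c B0 => // c IH B ltc gB sB.
case: (boolP [forall j, #|B j| == l]) => [/forallP all_l|/forallPn[j nj]].
  by exists B; split=> // j; exact/eqP.
have [j1 [j2 [lt1 lt2]]] : exists j1 j2, (l < #|B j1|)%N /\ (#|B j2| < l)%N.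
  have sl : (\sum_(j < k) l = k * l)%N by rewrite sum_nat_const card_ord.
  case: (pickP (fun j => (l < #|B j|)%N)) => [j1 lt1|nlt1].
    case: (pickP (fun j => (#|B j| < l)%N)) => [j2 lt2|nlt2]; first by exists j1, j2.
    have : (\sum_(j < k) l < \sum_j #|B j|)%N.
      rewrite (bigD1 j1) //= [leqRHS](bigD1 j1) //= -addSn leq_add //.
      by apply: leq_sum => i _; rewrite leqNgt nlt2.
    by rewrite sB sl ltnn.
  have : (\sum_j #|B j| < \sum_(j < k) l)%N.
    rewrite (bigD1 j) //= [leqRHS](bigD1 j) //= -addSn leq_add //.
      by rewrite ltn_neqAle nj leqNgt nlt1.
    by apply: leq_sum => i _; rewrite leqNgt nlt1.
  by rewrite sB sl ltnn.
have j12 : j2 != j1 by apply/eqP => E; move: lt2; rewrite E; lia.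
have cD : (#|B j2| + 2 <= #|B j1|)%N by lia.
have [a a1 [a2 ga]] : exists2 a, a \in B j1 & a \notin B j2 /\ has_nonedge (B j1 :\ a).
  have /existsP[e /and3P[eE e1 e2]] := gB j1.
  case: (boolP (B j2 \subset B j1)) => [sub|nsub].
    have /subsetPn[a a1 a2] : ~~ (B j1 \subset B j2).
      by apply/negP => /subset_leq_card; lia.
    exists a => //; split=> //; apply: has_nonedgeS (gB j2).
    by apply/subsetP => x x2; rewrite !inE (subsetP sub) // andbT; apply: contraNneq a2 => <-.
  (* [B j1] has at least two elements more than [B j2], and the intersection is smaller than [B j2],
     so the difference has at least three. *)
  have /subsetPn[a] : ~~ (B j1 :\: B j2 \subset [set e.1; e.2]).
    apply/negP => /subset_leq_card; rewrite cardsD cards2.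
    have : (#|B j1 :&: B j2| < #|B j2|)%N.
      apply: proper_card; rewrite properE subsetIr /=.
      by apply: contra nsub => /subset_trans; apply; exact: subsetIl.
    by case: (_ != _); lia.
  rewrite !inE negb_or => /andP[a2 a1] /andP[ne1 ne2]; exists a => //; split=> //.
  by apply/existsP; exists e; rewrite eE !inE e1 e2 !andbT ![_ == a]eq_sym ne1.
pose B' j := if j == j1 then B j1 :\ a else if j == j2 then a |: B j2 else B j.
have B'1 : B' j1 = B j1 :\ a by rewrite /B' eqxx.
have B'2 : B' j2 = a |: B j2 by rewrite /B' (negPf j12) eqxx.
have B'j i : i != j1 -> i != j2 -> B' i = B i by rewrite /B' => /negPf -> /negPf ->.
have c1 : #|B j1| = #|B' j1|.+1 by rewrite B'1 (cardsD1 a (B j1)) a1.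
have c2 : #|B' j2| = #|B j2|.+1 by rewrite B'2 cardsU1 a2.
have split12 (F : {set 'I_n} -> nat) (C : 'I_k -> {set 'I_n}) :
    (\sum_j F (C j) = F (C j1) + (F (C j2) +
       \sum_(j | (j != j1) && (j != j2)) F (C j)))%N.
  by rewrite (bigD1 j1) //= (bigD1 j2).
have rest (F : {set 'I_n} -> nat) : (\sum_(j | (j != j1) && (j != j2)) F (B' j) =
    \sum_(j | (j != j1) && (j != j2)) F (B j))%N.
  by apply: eq_bigr => i /andP[i1 i2]; rewrite B'j.
have [|||B'' [g'' c'' E'']] := IH B'.
- move: ltc; rewrite !(split12 (fun C => #|C| ^ 2)%N) (rest (fun C => #|C| ^ 2)%N) c2 ltnS.
  apply: leq_trans; rewrite !addnA ltn_add2r.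
  by move: cD; rewrite c1; nia.
- move=> i; rewrite /B'; case: ifP => _ //; case: ifP => _ //.
  by apply: has_nonedgeS (gB j2); exact: subsetUr.
- rewrite -sB !(split12 (fun C => #|C|)) (rest (fun C => #|C|)) c1 c2 addSn addSn addnS.
  by [].
exists B''; split=> //; rewrite E''.
rewrite (bigD1 j1) //= [in RHS](bigD1 j1) //= (bigD1 j2) //= [in RHS](bigD1 j2) //=.
rewrite !addmA; congr (_ + _)%MM; last by apply: eq_bigr => i /andP[i1 i2]; rewrite B'j.
apply/mnmP => p; rewrite !mnmDE !mnmE B'1 B'2 !inE.
by case: (p =P a) => [->|_] //=; rewrite a1 (negPf a2).
Qed.

End NonedgeProducts.

(** * Powers of the nonface ideal *)

Fixpoint pow_mons n (A : seq 'X_{1..n}) (k : nat) : seq 'X_{1..n} :=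
  if k is k'.+1 then [seq (a + b)%MM | a <- A, b <- pow_mons A k'] else [:: 0%MM].

Lemma pow_gens_mons n (K : fieldType) (A : seq 'X_{1..n}) k :
  pow_gens [seq 'X_[m] : {mpoly K[n]} | m <- A] k = [seq 'X_[m] | m <- pow_mons A k].
Proof.
elim: k => [|k IH] /=; first by rewrite mpolyX0.
rewrite IH allpairs_mapl allpairs_mapr map_allpairs.
by apply: eq_allpairs => a b; rewrite mpolyXD.
Qed.

Lemma sum_pow_mons n (A : seq 'X_{1..n}) k (F : 'I_k -> 'X_{1..n}) :
  (forall j, F j \in A) -> (\sum_j F j)%MM \in pow_mons A k.
Proof.
elim: k F => [|k IH] F FA; first by rewrite big_ord0 inE.
rewrite big_ord_recl /=; apply/allpairsP.
by exists (F ord0, \big[mnm_add/0%MM]_(j < k) F (lift ord0 j)) => /=; split=> //; exact: IH.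
Qed.

(** Only the sets of generators have to agree, so the list of products may be reordered and freed of
    repetitions. *)
Lemma in_ideal_monomials n (K : fieldType) (gs : seq {mpoly K[n]}) (s : seq 'X_{1..n}) p :
  gs =i [seq 'X_[m] | m <- s] ->
  in_ideal gs p <->
  exists v : 'rV_(size s), p = (v *m \col_(j < size s) 'X_[nth 0%MM s j]) 0 0.
Proof.
move=> Egs; split.
  case=> c ->; pose P (p : {mpoly K[n]}) := exists v : 'rV_(size s),
    p = (v *m \col_(j < size s) 'X_[nth 0%MM s j]) 0 0.
  apply: (big_ind P) => [|_ _ [v ->] [w ->]|j _].
  - by exists 0; rewrite mul0mx mxE.
  - by exists (v + w); rewrite mulmxDl [RHS]mxE.
  have : gs`_j \in gs by rewrite mem_nth.
  rewrite Egs => /mapP[m ms ->]; have im : (index m s < size s)%N by rewrite index_mem.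
  exists (c j *: delta_mx 0 (Ordinal im)).
  by rewrite -scalemxAl -rowE !mxE /= nth_index.
case=> v ->; rewrite mxE; apply: (big_ind (in_ideal gs)) => [|_ _ [c ->] [c' ->]|t _].
- by exists (fun=> 0); rewrite big1 // => j _; rewrite mul0r.
- by exists (fun j => c j + c' j); rewrite -big_split /=; apply: eq_bigr => j _; rewrite mulrDl.
have gt : 'X_[nth 0%MM s t] \in gs by rewrite Egs map_f // mem_nth.
have ig : (index ('X_[nth 0%MM s t] : {mpoly K[n]}) gs < size gs)%N by rewrite index_mem.
exists (fun j => if j == Ordinal ig then v 0 t else 0).
rewrite (bigD1 (Ordinal ig)) //= eqxx big1 ?addr0 => [|j /negPf ->]; last by rewrite mul0r.
by rewrite nth_index // mxE.
Qed.

Theorem theorem4p2 (K : fieldType) (n : nat) (Delta : {set {set 'I_n}}) (d l : nat) :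
  is_simplicial_complex Delta ->
  is_quasi_tree Delta ->
  has_dim_pred Delta d ->
  (l < d)%N ->
  forall k : nat, (1 <= k)%N ->
    has_linear_resolution (k * l.+1)%N
      (in_ideal (pow_gens (nonface_gens K Delta l) k)).
Proof.
move=> cplx qt _ _ k _.
have [tau [Fac [FacD Fac_nbr]]] := quasi_tree_elimination cplx qt.
pose N := [set F : {set 'I_n} | (#|F| == l.+1)%N && (F \notin Delta)].
pose A := [seq set_mon F | F <- enum N].
have memA F : F \in N -> set_mon F \in A by move=> FN; rewrite map_f // mem_enum.
have -> : nonface_gens K Delta l = [seq 'X_[m] | m <- A].
  by rewrite /nonface_gens -map_comp; apply: eq_map => F /=; exact: xF_set_mon.
rewrite pow_gens_mons.
have charZ z : z \in undup (pow_mons A k) <-> [/\ mdeg z = (k * l.+1)%N,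
    forall i, (z i <= k)%N & exists M, divisor_product (@edge_mon n) (nonedge Delta tau) k z M].
  rewrite mem_undup; split.
    (* Each factor contains a nonedge and, being squarefree, raises every exponent by at most
       one. *)
    elim: k z => [|k IH] z /=.
      rewrite inE => /eqP ->; rewrite mdeg0; split=> // [i|]; first by rewrite mnm0E.
      by exists [::]; split=> //; rewrite /smon big_nil lepm_refl.
    case/allpairsP=> -[a b] /= [/mapP[F]]; rewrite mem_enum inE => /andP[/eqP cF FD] Ea.
    move=> /IH[db bk [M [sM ME Mb]]] ->.
    have [|e eE /andP[e1 e2]] := nonface_nonedge cplx FacD Fac_nbr FD.
      by rewrite -card_gt0 cF.
    rewrite Ea mdegD mdeg_set_mon cF db mulSn; split=> // [i|].
      by rewrite mnmDE mnmE; have := bk i; case: (_ \in _) => /=; lia.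
    exists (e :: M); split; rewrite /= ?sM ?ME ?andbT //.
    rewrite smon_cons; apply/mnm_lepP => i; rewrite mnmDE [leqRHS]mnmDE.
    apply: leq_add (mnm_lepP Mb i); rewrite mnmDE !mnm1E mnmE.
    have ne : e.1 != e.2 by apply/eqP => E; move: eE; rewrite inE E ltnn andbF.
    case: (e.1 =P i) => [<-|_]; first by rewrite e1 eq_sym (negPf ne).
    by case: (e.2 =P i) => [<-|_] //; rewrite e2.
  case=> dz zk [M [sM ME Mz]].
  (* Conversely, the variables are distributed over the nonedges and the sets balanced; their sizes
     add up to the degree of [z]. *)
  have [B0 gB0 Ez] := nonedge_fill sM ME Mz zk.
  have [|B [gB cB EB]] := @nonedge_balance _ _ _ k l.+1 B0 gB0.
    rewrite -dz Ez mdeg_sum; apply: eq_bigr => j _; exact/esym/mdeg_set_mon.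
  rewrite Ez -EB; apply: sum_pow_mons => j; apply: memA.
  by rewrite inE cB eqxx (has_nonedge_notin cplx (gB j)).
have [s sZ Hs] := sorted_exchange (@edge_mon_pair _ Delta tau) (@edge_rank_inj _ _ _)
  (nonedge_exchange cplx FacD Fac_nbr) (undup_uniq _) charZ.
apply: (@linear_quotients_resolution _ _ _ _ (\col_(j < size s) 'X_[nth 0%MM s j])).
- move=> j; rewrite mxE dhomogX; apply/eqP.
  by have /charZ[] : nth 0%MM s j \in undup (pow_mons A k) by rewrite -sZ mem_nth.
- exact: monomial_linear_quotients.
move=> p; apply: in_ideal_monomials => q.
by apply/mapP/mapP => -[m ms ->]; exists m => //; move: ms; rewrite sZ mem_undup.
Qed.
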